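(* Let $\psi: T \to \mathbb{C}$ be a function and $\varphi: T \to T$ a self-map for which $W_{\psi,\varphi}$ is bounded on $L_\mu^\infty$ (respectively $L_\mu^0$). Then $W_{\psi,\varphi}$ is bounded below on $L_\mu^\infty$ (respectively $L_\mu^0$) if and only if $\varphi$ is surjective and there is an $\varepsilon > 0$ such that $U_\varepsilon \cap S_w \ne \emptyset$ for every $w \in T$, where $$U_\varepsilon = \left\{v \in T : \frac{\mu(v)}{\mu(\varphi(v))}|\psi(v)| \ge \varepsilon\right\}, \qquad S_w = \{v \in T : \varphi(v) = \varphi(w)\}.$$
   Context: $(T,\mathrm{d})$ is a metric space with a distinguished point $o$ (the root); the length of $v \in T$ is $|v| = \mathrm{d}(o,v)$. $T$ is assumed locally finite (for every $M>0$ the set $\{v \in T : |v| < M\}$ is finite) and unbounded (for every $M>0$ there is $v \in T$ with $|v| \ge M$). $\mu: T \to (0,\infty)$ is an arbitrary positive function (a weight). $L_\mu^\infty$ is the Banach space of functions $f: T \to \mathbb{C}$ with $\|f\|_\mu = \sup_{v \in T} \mu(v)|f(v)| < \infty$, and $L_\mu^0$ is its closed subspace of those $f$ with $\lim_{|v|\to\infty} \mu(v)|f(v)| = 0$. The weighted composition operator is the linear map $W_{\psi,\varphi} f = \psi\,(f\circ\varphi)$; it is bounded on a space if it is a bounded operator from that space to itself. A bounded operator $A: X \to Y$ between Banach spaces is bounded below if there is $\delta > 0$ with $\|Ax\|_Y \ge \delta \|x\|_X$ for all $x \in X$. *)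

(* Defs.v *)
From HB Require Import structures.
From mathcomp Require Import all_boot all_order all_algebra.
From mathcomp Require Import all_classical all_reals all_analysis.
From mathcomp Require Import complex.

Set Implicit Arguments.
Unset Strict Implicit.
Unset Printing Implicit Defensive.

Import Order.TTheory GRing.Theory Num.Theory.
Import numFieldNormedType.Exports.

Local Open Scope classical_set_scope.
Local Open Scope ring_scope.
Local Open Scope complex_scope.

Section RootedMetricSpace.
Context {R : realType} {T : metricType R}.
Variable o : T.

Definition vlength (v : T) : R := mdist o v.

Definition locally_finite : Prop :=
  forall M : R, 0 < M -> finite_set [set v | vlength v < M].

Definition unbounded : Prop :=
  forall M : R, 0 < M -> exists v, M <= vlength v.

(* The filter along which [|v|] tends to infinity; it is proper exactly when
   the space is unbounded. *)
Definition length_infty : set_system T :=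
  filter_from [set: R] (fun M => [set v | M <= vlength v]).

#[global] Instance length_infty_filter : Filter length_infty.
Proof.
apply: filter_from_filter; first by exists 0.
move=> M N _ _; exists (Num.max M N) => // v /=.
by rewrite ge_max => /andP[].
Qed.

End RootedMetricSpace.

Section WeightedSpaces.
Context {R : realType} {T : metricType R}.

(* [`|z|] in [R[i]] is again complex-valued; [normc z] is the modulus in [R]. *)
Definition wabs (mu : T -> R) (f : T -> R[i]) (v : T) : R :=
  mu v * ComplexField.Normc.normc (f v).

Definition wnorm (mu : T -> R) (f : T -> R[i]) : \bar R :=
  ereal_sup (range (fun v => (wabs mu f v)%:E)).

Definition Linfty (mu : T -> R) : set (T -> R[i]) :=
  [set f | (wnorm mu f < +oo)%E].

Definition Lzero (o : T) (mu : T -> R) : set (T -> R[i]) :=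
  [set f | Linfty mu f /\ wabs mu f v @[v --> length_infty o] --> (0 : R)].

(* [X] stands for a space normed by [wnorm mu]. Operators are linear maps on
   all functions [T -> R[i]]; being an operator on [X] includes stability of
   [X]. *)
Definition bounded_on (mu : T -> R) (X : set (T -> R[i]))
    (A : {linear (T -> R[i]) -> (T -> R[i])}) : Prop :=
  (forall f, X f -> X (A f)) /\
  exists M : R, forall f, X f -> (wnorm mu (A f) <= M%:E * wnorm mu f)%E.

Definition bounded_below_on (mu : T -> R) (X : set (T -> R[i]))
    (A : {linear (T -> R[i]) -> (T -> R[i])}) : Prop :=
  exists2 delta : R, 0 < delta &
    forall f, X f -> (delta%:E * wnorm mu f <= wnorm mu (A f))%E.

Definition wcomp (psi : T -> R[i]) (phi : T -> T) (f : T -> R[i]) : T -> R[i] :=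
  fun v => psi v * f (phi v).

Lemma wcomp_is_linear psi phi : linear (wcomp psi phi).
Proof.
move=> a f g; apply/funext => v.
by rewrite /wcomp !fctE mulrDr [in LHS]mulrCA.
Qed.

HB.instance Definition _ psi phi :=
  GRing.isLinear.Build R[i] (T -> R[i]) (T -> R[i]) *:%R (wcomp psi phi)
    (wcomp_is_linear psi phi).

Definition Uset (mu : T -> R) (psi : T -> R[i]) (phi : T -> T) (eps : R) :
    set T :=
  [set v | eps <= mu v / mu (phi v) * ComplexField.Normc.normc (psi v)].

Definition Sset (phi : T -> T) (w : T) : set T := [set v | phi v = phi w].

End WeightedSpaces.

(* Main.v *)
(** Both spaces contain the point masses, and [W] sends the mass at [u] to
    [psi] restricted to the fibre over [u]. Testing a lower bound [delta] on
    the mass at [u] therefore produces a point [v] of that fibre (so [phi] is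
    onto) with [mu v * |psi v| > delta / 2 * mu u]. Conversely, evaluating
    [W f] at such a point of the fibre over [u] gives [eps * mu u * |f u|] as a
    lower bound of its norm, for every [u] in the range of [phi]. *)
Require Import Defs.
From HB Require Import structures.
From mathcomp Require Import all_boot all_order all_algebra.
From mathcomp Require Import all_classical all_reals all_analysis.
From mathcomp Require Import complex.
Import Order.TTheory GRing.Theory Num.Theory.
Import numFieldNormedType.Exports.
Local Open Scope classical_set_scope.
Local Open Scope ring_scope.
Local Open Scope complex_scope.

Definition point_mass {R : realType} {T : metricType R} (u : T) : T -> R[i] :=
  fun v => if v == u then 1 else 0.

Lemma wabs_point_mass {R : realType} {T : metricType R} (mu : T -> R) (u v : T) :
  wabs mu (point_mass u) v = if v == u then mu u else 0.
Proof.
rewrite /wabs /point_mass; case: eqVneq => [->|_].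
  by rewrite ComplexField.Normc.normc1 mulr1.
by rewrite ComplexField.Normc.normc0 mulr0.
Qed.

Lemma wabs_wcomp {R : realType} {T : metricType R} (mu : T -> R)
    (psi : T -> R[i]) (phi : T -> T) (f : T -> R[i]) (v : T) :
  wabs mu (wcomp psi phi f) v =
  mu v * ComplexField.Normc.normc (psi v) * ComplexField.Normc.normc (f (phi v)).
Proof. by rewrite /wabs /wcomp ComplexField.Normc.normcM mulrA. Qed.

Lemma wabs_le_wnorm {R : realType} {T : metricType R} (mu : T -> R)
    (f : T -> R[i]) (v : T) : ((wabs mu f v)%:E <= wnorm mu f)%E.
Proof. by apply: ereal_sup_ubound; exists v. Qed.

Lemma wnorm_point_mass {R : realType} {T : metricType R} (mu : T -> R)
    (mu_gt0 : forall v, 0 < mu v) (u : T) :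
  wnorm mu (point_mass u) = (mu u)%:E.
Proof.
apply/eqP; rewrite eq_le; apply/andP; split.
  apply: ge_ereal_sup => _ [v _ <-]; rewrite lee_fin wabs_point_mass.
  by case: ifP => // _; exact: ltW.
by have := wabs_le_wnorm mu (point_mass u) u; rewrite wabs_point_mass eqxx.
Qed.

Lemma point_mass_Linfty {R : realType} {T : metricType R} (mu : T -> R)
    (mu_gt0 : forall v, 0 < mu v) (u : T) : Linfty mu (point_mass u).
Proof. by rewrite /Linfty /= wnorm_point_mass// ltry. Qed.

Lemma point_mass_Lzero {R : realType} {T : metricType R} (o : T) (mu : T -> R)
    (mu_gt0 : forall v, 0 < mu v) (u : T) : Lzero o mu (point_mass u).
Proof.
split; first exact: point_mass_Linfty.
(* The neighbourhoods of infinity are the sets [M <= vlength o v], with [M] included; the [+ 1] is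
   what keeps [u] itself out, so that the mass vanishes there. *)
apply: cvg_near_cst; exists (vlength o u + 1) => // v /= le_v.
rewrite wabs_point_mass; case: eqVneq => // vu.
by move: le_v; rewrite vu gerDl ler10.
Qed.

(** Keeping [X] abstract lets one argument serve both [Linfty mu] and [Lzero o mu]: the spaces enter
    only through their point masses. *)
Lemma bounded_below_wcompP {R : realType} {T : metricType R} (mu : T -> R)
    (mu_gt0 : forall v, 0 < mu v) (psi : T -> R[i]) (phi : T -> T)
    (X : set (T -> R[i])) (X_mass : forall u, X (point_mass u)) :
  bounded_below_on mu X (wcomp psi phi) <->
  set_surj [set: T] [set: T] phi /\
  exists2 eps : R, 0 < eps &
    forall w : T, Uset mu psi phi eps `&` Sset phi w !=set0.
Proof.
split=> [[delta delta_gt0 below]|[phi_surj [eps eps_gt0 meet]]].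
  (* The supremum defining [wnorm] need not be attained; halving [delta] gives a strict inequality,
     which some point [v] must then witness. *)
  have half_gt0 : 0 < delta / 2 by rewrite divr_gt0.
  have fibre u : exists2 v, phi v = u &
      delta / 2 <= mu v / mu (phi v) * ComplexField.Normc.normc (psi v).
    have : ((delta / 2 * mu u)%:E < wnorm mu (wcomp psi phi (point_mass u)))%E.
      apply: lt_le_trans (below _ (X_mass u)).
      rewrite wnorm_point_mass// -EFinM lte_fin ltr_pM2r//.
      by rewrite ltr_pdivrMr// ltr_pMr// ltr1n.
    case/ereal_sup_gt => _ [v _ <-]; rewrite lte_fin wabs_wcomp /point_mass.
    case: eqVneq => [phiv|_].
      rewrite ComplexField.Normc.normc1 mulr1 => /ltW le_v; exists v => //.
      by rewrite phiv mulrAC ler_pdivlMr.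
    (* Off the fibre over [u] the image of the mass is zero, which cannot exceed the positive
       [delta / 2 * mu u]. *)
    rewrite ComplexField.Normc.normc0 mulr0 => lt0.
    by have := lt_trans lt0 (mulr_gt0 half_gt0 (mu_gt0 u)); rewrite ltxx.
  split; first by move=> u _; have [v <- _] := fibre u; exists v.
  exists (delta / 2) => // w; have [v phiv le_v] := fibre (phi w).
  by exists v; split.
(* Moving [eps] to the right isolates the supremum [wnorm mu f], which is then bounded one point [u]
   at a time. *)
exists eps => // f _; rewrite -lee_pdivlMl//.
apply: ge_ereal_sup => _ [u _ <-]; rewrite lee_pdivlMl//.
(* Surjectivity makes the fibre over [u] one of the sets [Sset phi w]. *)
have [w _ <-] := phi_surj u I; have [v [/= le_v phiv]] := meet w.
apply: le_trans (wabs_le_wnorm _ _ v).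
rewrite wabs_wcomp phiv -EFinM lee_fin /wabs mulrA.
(* [normc] matches on its argument; splitting [f _] into real and imaginary parts exposes a square
   root. *)
apply: ler_wpM2r; first by case: (f _) => a b; rewrite sqrtr_ge0.
by rewrite -ler_pdivlMr// mulrAC -phiv.
Qed.

Theorem theorem5p2 (R : realType) (T : metricType R) (o : T)
    (T_locally_finite : locally_finite o) (T_unbounded : unbounded o)
    (mu : T -> R) (mu_gt0 : forall v : T, 0 < mu v)
    (psi : T -> R[i]) (phi : T -> T) :
  (bounded_on mu (Linfty mu) (wcomp psi phi) ->
    (bounded_below_on mu (Linfty mu) (wcomp psi phi) <->
      set_surj [set: T] [set: T] phi /\
      exists2 eps : R, 0 < eps &
        forall w : T, Uset mu psi phi eps `&` Sset phi w !=set0)) /\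
  (bounded_on mu (Lzero o mu) (wcomp psi phi) ->
    (bounded_below_on mu (Lzero o mu) (wcomp psi phi) <->
      set_surj [set: T] [set: T] phi /\
      exists2 eps : R, 0 < eps &
        forall w : T, Uset mu psi phi eps `&` Sset phi w !=set0)).
Proof.
split=> _; apply: bounded_below_wcompP => // u.
  exact: point_mass_Linfty.
exact: point_mass_Lzero.
Qed.
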